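(* Let $X$ be a simplicial surface. Then $X$ is face-transitive with $\mathrm{vf}(X)=(1,2)$ if and only if $H:=\lambda_X(\mathrm{Aut}(X))$ is a $(1,2)$-group of the face graph $\mathcal F(X)$ and the cycle double cover $\mathcal C^{(1,2)}(H)$ (for a suitable choice of the data defining it) contains the vertex-defining cycles of $X$.
   Context: A simplicial complex $X$ on a finite non-empty set $P$ is a non-empty family of subsets of $P$ closed under taking subsets; $X_i$ is the set of its elements of cardinality $i+1$; elements of $X_0,X_1,X_2$ are vertices, edges, faces. A simplicial surface is a simplicial complex $X$ such that: all inclusion-maximal elements have cardinality $3$; every edge lies in exactly two faces; and for every vertex $v$ the faces containing $v$ can be arranged in a cyclic sequence $u(v)=(F_1,\dots,F_n)$ (each once), the umbrella of $v$, with $|F_i\cap F_{i+1}|=2$ (subscripts mod $n$). Simplicial surfaces are assumed strongly connected (any two faces joined by a sequence of faces with consecutive ones sharing an edge). $\mathrm{Aut}(X)$ is the automorphism group (permutations of $X_0$ mapping faces to faces). $X$ is face-transitive if $\mathrm{Aut}(X)$ is transitive on $X_2$; then $\mathrm{vf}(X)=(a,s)$ with $a$ the number of $\mathrm{Aut}(X)$-orbits on $X_0$ and $s$ the order of the stabiliser in $\mathrm{Aut}(X)$ of a face. All graphs are finite, simple, undirected, connected; their elements are called nodes and arcs. The face graph $\mathcal F(X)$ has node set $X_2$, two faces being joined by an arc iff they share an edge; it is cubic. $\lambda_X:\mathrm{Aut}(X)\to\mathrm{Aut}(\mathcal F(X))$ is the injective homomorphism sending an automorphism to the permutation it induces on $X_2$.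 Each umbrella $u(v)$ is a cycle in $\mathcal F(X)$, called a vertex-defining cycle of $X$. Cycles are considered up to rotation and reversal; for a subgroup $H$ of the automorphism group of a graph and a cycle $C$, $C^H$ denotes the $H$-orbit of $C$ under the induced action on cycles. A cycle double cover of a cubic graph is a set of cycles such that every arc lies in exactly two of them. It is vertex-faithful if all its cycles are chordless and any two distinct cycles share at most one arc. $\alpha$-cycles: let $\mathcal G=(V,E)$ be a cubic node-transitive graph (i.e. $\mathrm{Aut}(\mathcal G)$ is transitive on $V$), $F_1,\dots,F_n\in V$ with $\{F_i,F_{i+1}\}\in E$ for $1\le i\le n-1$, and $\sigma\in\mathrm{Aut}(\mathcal G)$ of order $\ell$ with $\sigma(F_1)=F_n$. Put $\Sigma=\{\sigma^i(F_j): 0\le i\le \ell-1,\ 1\le j\le n-1\}$. If $|\Sigma|=(n-1)\ell$, then $\alpha(\sigma,F_1,\dots,F_n)$ is the cycle $(\sigma(F_1),\dots,\sigma(F_{n-1}),\dots,\sigma^\ell(F_1),\dots,\sigma^\ell(F_{n-1}))$; otherwise it is the empty cycle. A subgroup $H\le\mathrm{Aut}(\mathcal G)$ is a $(1,2)$-group of $\mathcal G$ if: (1) $H$ acts transitively on $V$ with $|H|=2|V|$; (2) $E$ partitions into two $H$-orbits $E_1,E_2$ with $|E_1|=|V|$ and $|E_2|=\tfrac12|V|$; (3) there are $F_1,F_2,F_3,F_4\in V$ with $\{F_1,F_2\}\in E_2$ and $\{F_2,F_3\},\{F_3,F_4\}\in E_1$, and $\sigma\in\mathrm{Aut}(\mathcal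 G)$ with $\sigma(F_1)=F_4$, such that $\alpha(\sigma,F_1,F_2,F_3,F_4)^H$ is a vertex-faithful cycle double cover of $\mathcal G$. This cover is denoted $\mathcal C^{(1,2)}(H)$. *)

(* Defs.v *)
From mathcomp Require Import all_boot all_fingroup.

Set Implicit Arguments.
Unset Strict Implicit.
Unset Printing Implicit Defensive.

Local Open Scope group_scope.
Local Open Scope nat_scope.

(* A graph is an adjacency relation on the finite type of its nodes; an arc is
   the two-element set of its end nodes. *)
Section Graphs.

Variable T : finType.
Implicit Types (e : rel T) (s t : seq T) (H : {set {perm T}}).

Definition autG e : {set {perm T}} :=
  [set g : {perm T} | [forall x, [forall y, e (g x) (g y) == e x y]]].

Definition arcs e : {set {set T}} := [set [set x; y] | x in T, y in e x].

Definition is_cycle e s : bool := [&& 2 < size s, uniq s & path.cycle e s].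

Definition cyc_equiv s t : bool :=
  [exists i : 'I_(size s).+1, (t == rot i s) || (t == rev (rot i s))].

(* A cycle up to rotation and reversal is a class of sequences of nodes.
   Members of such a class are duplicate-free, so bounding their length by #|T|
   excludes none of them and keeps the type of classes finite. *)
Definition gcycle : Type := {set {bseq #|T| of T}}.

Definition cycle_class s : gcycle :=
  [set t : {bseq #|T| of T} | cyc_equiv s t].

Definition cycle_nodes (c : gcycle) : {set T} :=
  [set x | [exists t in c, x \in val t]].

Definition cycle_arcs (c : gcycle) : {set {set T}} :=
  \bigcup_(t in c) [set [set x; next (val t) x] | x in val t].

(* The H-orbit of the class of s. *)
Definition cycle_orbit H s : {set gcycle} :=
  [set cycle_class [seq (h : {perm T}) x | x <- s] | h in H].

Record cycle_double_cover e (C : {set gcycle}) : Prop := CycleDoubleCover {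
  cdc_cycles : forall c, c \in C -> exists2 s, is_cycle e s & c = cycle_class s;
  cdc_double : forall a, a \in arcs e -> #|[set c in C | a \in cycle_arcs c]| = 2
}.

Definition chordless e (c : gcycle) : Prop :=
  forall x y, x \in cycle_nodes c -> y \in cycle_nodes c -> e x y ->
    [set x; y] \in cycle_arcs c.

Definition vertex_faithful e (C : {set gcycle}) : Prop :=
  (forall c, c \in C -> chordless e c) /\
  (forall c d, c \in C -> d \in C -> c != d ->
     #|cycle_arcs c :&: cycle_arcs d| <= 1).

(* alpha sigma F1 [:: F2; ...; Fn] is the cycle alpha(sigma, F1, ..., Fn):
   belast F1 [:: F2; ...; Fn] is F1, ..., F(n-1), and size p is n - 1. *)
Definition alpha_support (sigma : {perm T}) (x : T) (p : seq T) : {set T} :=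
  [set (sigma ^+ (i : 'I_#[sigma])) y | i in 'I_#[sigma], y in belast x p].

Definition alpha (sigma : {perm T}) (x : T) (p : seq T) : seq T :=
  if #|alpha_support sigma x p| == size p * #[sigma] then
    flatten [seq [seq (sigma ^+ i) y | y <- belast x p] | i <- iota 1 #[sigma]]
  else [::].

Record arc_orbits_12 e (H : {group {perm T}}) (E1 E2 : {set {set T}}) : Prop :=
  ArcOrbits12 {
    ao12_orbits : [set orbit 'P^* H a | a in arcs e] = [set E1; E2];
    ao12_neq : E1 != E2;
    ao12_card1 : #|E1| = #|T|;
    ao12_card2 : 2 * #|E2| = #|T|
  }.

(* C is a cover C^(1,2)(H), for some choice of F1, F2, F3, F4 and sigma. *)
Definition is_cover_12 e (H : {group {perm T}}) (C : {set gcycle}) : Prop :=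
  exists E1 E2 : {set {set T}}, arc_orbits_12 e H E1 E2 /\
  exists (F1 F2 F3 F4 : T) (sigma : {perm T}),
    [/\ [set F1; F2] \in E2, [set F2; F3] \in E1 & [set F3; F4] \in E1] /\
    [/\ sigma \in autG e, sigma F1 = F4,
        C = cycle_orbit H (alpha sigma F1 [:: F2; F3; F4]),
        cycle_double_cover e C & vertex_faithful e C].

(* The existence of a cover includes the splitting of the arcs into two
   orbits, see is_cover_12. *)
Record group_12 e (H : {group {perm T}}) : Prop := Group12 {
  g12_sub : H \subset autG e;
  g12_trans : [transitive H, on [set: T] | 'P];
  g12_card : #|H| = 2 * #|T|;
  g12_cover : exists C, is_cover_12 e H C
}.

End Graphs.

Section Surfaces.

Variable P : finType.
Implicit Type X : {set {set P}}.

Definition simplicial_complex X : Prop :=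
  X != set0 /\ (forall A B : {set P}, A \in X -> B \subset A -> B \in X).

Definition simplices X (i : nat) : {set {set P}} := [set A in X | #|A| == i.+1].

(* A vertex [set p] is identified with the point p. *)
Definition vertices X : {set P} := [set p | [set p] \in X].

Definition face X : finType := {F : {set P} | F \in simplices X 2}.

Definition face_graph X : rel (face X) := fun F G =>
  (F != G) &&
  [exists A in simplices X 1, (A \subset val F) && (A \subset val G)].

Definition umbrella X (v : P) (u : seq (face X)) : Prop :=
  [/\ uniq u, forall F : face X, (F \in u) = (v \in val F)
    & path.cycle (fun F G : face X => #|val F :&: val G| == 2) u].

Record simplicial_surface X : Prop := SimplicialSurface {
  surf_complex : simplicial_complex X;
  surf_max : forall A : {set P}, maxset (mem X) A -> #|A| = 3;
  surf_edge : forall A, A \in simplices X 1 ->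
    #|[set F in simplices X 2 | A \subset F]| = 2;
  surf_umbrella : forall v, v \in vertices X -> exists u, @umbrella X v u;
  surf_conn : forall F G : face X, connect (@face_graph X) F G
}.

(* Permutations of the vertices are permutations of P supported on them. *)
Definition autX X : {group {perm P}} :=
  (Sym (vertices X) :&: 'N(simplices X 2 | 'P^*))%G.

Definition face_transitive X : Prop :=
  [transitive autX X, on simplices X 2 | 'P^*].

(* vf(X) = (a, s); meaningful for face-transitive X. *)
Definition has_vf X (a s : nat) : Prop :=
  #|[set orbit 'P (autX X) v | v in vertices X]| = a /\
  (forall F, F \in simplices X 2 -> #|'C_(autX X)[F | 'P^*]| = s).

(* The permutations of P preserving the set of faces act on the faces; autX X is
   contained in the domain of this action. *)
Definition face_action X := (('P^*)^? : action _ (face X))%act.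

Definition lambda X := [morphism of actperm (face_action X)].

End Surfaces.

(* Main.v *)
(** Call apex of a face its vertex fixed by its stabiliser of order two, and
    call the opposite edge the base.  The group acts regularly on
    the pairs (face, base vertex).  Counting shows that a base edge is the base
    of both its faces, so the arcs of the face graph fall into the base orbit
    and the leg orbit.  Since all vertices are equivalent, base arcs occur in
    every umbrella, and by regularity every umbrella reads base, leg, leg,
    base, leg, leg, ...; the automorphism moving the umbrella by one period is
    the sigma of an alpha-cycle, whose orbit consists of all the umbrellas.
    Conversely, |H| = 2|V| gives the order of the stabilisers, and a vertex is
    determined by the faces of its umbrella, so that a single orbit of cycles
    forces a single orbit of vertices. *)

Require Import Defs.
From mathcomp Require Import all_boot all_fingroup cyclic zify.

Set Implicit Arguments.
Unset Strict Implicit.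
Unset Printing Implicit Defensive.

Local Open Scope group_scope.
Local Open Scope nat_scope.

(** * Cyclic sequences up to rotation and reversal *)

Section CyclicSequences.

Variable T : finType.
Implicit Types (s t : seq T) (x y : T).

Lemma cycle_iter_next s x y :
  uniq s -> x \in s -> y \in s -> exists i, y = iter i (next s) x.
Proof.
move=> us xs ys; have := fconnect_cycle (cycle_next us) xs y.
by rewrite ys => /iter_findex <-; exists (findex (next s) x y).
Qed.

(** The [next]-orbit of [x] is all of [s], so a return after two steps would force [size s] to be at
    most two. *)
Lemma next_next_neq s x : uniq s -> 2 < size s -> x \in s ->
  next s (next s x) != x.
Proof.
move=> us s_gt2 xs; apply/eqP => nnx.
have := order_cycle (cycle_next us) us xs.
have: fingraph.order (next s) x <= 2.
  rewrite -(size_orbit) -[2]/(size [:: x; next s x]).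
  apply: uniq_leq_size => [|y]; first exact: orbit_uniq.
  rewrite -fconnect_orbit => /iter_findex <-.
  elim: (findex _ _ _) => [|i]; first by rewrite mem_head.
  by rewrite iterS !inE => /orP[]/eqP-> ; rewrite ?nnx eqxx ?orbT.
by move=> + sE; rewrite sE leqNgt s_gt2.
Qed.

Lemma next_neq_prev s x : uniq s -> 2 < size s -> x \in s ->
  next s x != prev s x.
Proof.
move=> us s_gt2 xs; apply: contraNneq (next_next_neq us s_gt2 xs) => ->.
by rewrite next_prev.
Qed.

(* A cycle running along the arcs of s never turns back, so its direction is
   fixed by any one of its steps. *)
Lemma next_propagate s t x : uniq s -> uniq t -> 2 < size t -> s =i t ->
    {in s, forall y, next t y = next s y \/ next t y = prev s y} ->
  x \in s -> next t x = next s x -> {in s, next t =1 next s}.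
Proof.
move=> us ut t_gt2 st nt xs ntx y ys.
have [i ->] := cycle_iter_next us xs ys.
elim: i => // i; set z := iter i _ x => IH.
have zs : z \in s by rewrite /z; elim: (i) => //= j; rewrite mem_next.
rewrite iterS -/z; have /nt[//|nz] : next s z \in s by rewrite mem_next.
have := @next_next_neq t z ut t_gt2; rewrite -st => /(_ zs).
by rewrite IH nz prev_next ?eqxx.
Qed.

(** Rotated to start at [x], both sequences are trajectories of [next s] of the same length. *)
Lemma eq_next_rot s t x : uniq s -> uniq t -> s =i t -> x \in s ->
  {in s, next t =1 next s} -> exists2 i, i <= size s & t = rot i s.
Proof.
move=> us ut st xs nst.
have sz : size t = size s by apply/perm_size/uniq_perm => // y; rewrite st.
have xt : x \in t by rewrite -st.
have [i s' si] := rot_to xs; have [j t' tj] := rot_to xt.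
have rots : fcycle (next s) (x :: s').
  by rewrite -si rot_cycle cycle_next.
have rott : fcycle (next s) (x :: t').
  rewrite -tj rot_cycle; apply: cycle_from_next => // y yt.
  by rewrite /= nst // st.
have szs : (size s').+1 = size s by rewrite -(size_rot i s) si.
have szt : (size t').+1 = size t by rewrite -(size_rot j t) tj.
have E : rot i s = rot j t.
  rewrite si tj; congr cons.
  move: rots rott; rewrite /= => /fpathP[m ms] /fpathP[m' mt].
  move: (congr1 size ms) (congr1 size mt); rewrite !size_rcons !size_traject.
  move=> sm tm; have mm : m = m' by lia.
  by move: ms; rewrite mm -mt => /rcons_inj[].
have tE : t = rotr j (rot i s) by rewrite E rotK.
rewrite tE /rotr rot_rot_add; exists (rot_add s i (size (rot i s) - j)) => //.
exact: leq_rot_add.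
Qed.

Lemma cyc_equivP s t : reflect
  (exists2 i, i <= size s & t = rot i s \/ t = rev (rot i s)) (cyc_equiv s t).
Proof.
apply: (iffP existsP) => [[i /orP[]/eqP->]|[i ile]].
- by exists (i : nat); [rewrite -ltnS | left].
- by exists (i : nat); [rewrite -ltnS | right].
by move=> tE; exists (inord i); rewrite inordK //; case: tE => <-; rewrite eqxx ?orbT.
Qed.

(** One step of [t] decides its direction: if it follows [s], propagation makes [t] a rotation of
    [s]; otherwise the same argument runs with [rev s]. *)
Lemma cyc_equiv_cycle s t : uniq s -> uniq t -> 2 < size t -> s =i t ->
    {in s, forall y, next t y = next s y \/ next t y = prev s y} ->
  cyc_equiv s t.
Proof.
move=> us ut t_gt2 st nt.
have sz : size t = size s by apply/perm_size/uniq_perm => // y; rewrite st.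
have [x xs] : exists x, x \in s.
  by case: (s) sz t_gt2 => [->|x s' _ _] //; exists x; rewrite mem_head.
apply/cyc_equivP.
have [ntx|ntx] := nt x xs.
  have [i] := eq_next_rot us ut st xs (next_propagate us ut t_gt2 st nt xs ntx).
  by exists i => //; left.
have rs : rev s =i t by move=> y; rewrite mem_rev st.
have urs : uniq (rev s) by rewrite rev_uniq.
have xrs : x \in rev s by rewrite mem_rev.
have nrt : {in rev s, forall y, next t y = next (rev s) y \/ next t y = prev (rev s) y}.
  by move=> y; rewrite mem_rev next_rev // prev_rev // => /nt[]; [right|left].
have ntx' : next t x = next (rev s) x by rewrite next_rev.
have [i ile ->] := eq_next_rot urs ut rs xrs
  (next_propagate urs ut t_gt2 rs nrt xrs ntx').
(* Rotating [rev s] by [i] is the same as reversing the rotation of [s] by [size s - i]. *)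
rewrite size_rev in ile; exists (size s - i); first exact: leq_subr.
by right; rewrite rev_rot /rotr size_rev subKn.
Qed.

(** [next s x] and [prev s x] are two distinct elements of [N], so they exhaust it. *)
Lemma cycle_neighbours (r : rel T) s (N : {set T}) x y :
    symmetric r -> uniq s -> 2 < size s -> path.cycle r s -> #|N| <= 2 ->
    (forall z, z \in s -> r x z -> z \in N) ->
  x \in s -> y \in s -> r x y -> y = next s x \/ y = prev s x.
Proof.
move=> rsym us s_gt2 cs N2 nbN xs ys rxy.
have sub : [set next s x; prev s x] \subset N.
  apply/subsetP => z /set2P[]->; apply: nbN; rewrite ?mem_next ?mem_prev //.
    exact: next_cycle.
  by rewrite rsym; apply: prev_cycle.
have NE : [set next s x; prev s x] = N.
  by apply/eqP; rewrite eqEcard sub cards2 next_neq_prev.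
by apply/set2P; rewrite NE nbN.
Qed.

Lemma rel_cycle_rev (r : rel T) s : symmetric r ->
  path.cycle r s -> path.cycle r (rev s).
Proof. by move=> rsym; rewrite rev_cycle; apply: sub_cycle => x y; rewrite rsym. Qed.

(** * Permutations that advance a cycle by three steps *)

Section Shift.

Variables (s : seq T) (sigma : {perm T}) (x : T).
Hypotheses (us : uniq s) (xs : x \in s)
  (comm : {in s, forall y, sigma (next s y) = next s (sigma y)})
  (sx : sigma x = iter 3 (next s) x).

Local Notation f i := (iter i (next s) x).

Lemma mem_iter_next i : f i \in s.
Proof. by elim: i => //= i; rewrite mem_next. Qed.

Lemma shift_power k i : (sigma ^+ k)%g (f i) = f (3 * k + i).
Proof.
have sf j : sigma (f j) = f (3 + j).
  by elim: j => [|j IH]; rewrite ?sx //= comm ?mem_iter_next // IH.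
elim: k i => [|k IH] i; first by rewrite expg0 perm1.
by rewrite expgS permM sf IH; congr iter; lia.
Qed.

Lemma iter_next_size i : f (size s + i) = f i.
Proof.
rewrite addnC iterD -(order_cycle (cycle_next us) us xs).
by rewrite (iter_order_cycle (cycle_next us) xs xs).
Qed.

(** Write [size s] as 3q + r. Then [sigma ^+ q] sends [f r] to [x] and [f r.+1] to [f 1], so [b]
    steps forward at [f r]; the last two hypotheses exclude r = 1 and r = 2. *)
Lemma shift_dvd_size (b : T -> T) :
    (forall y, sigma (b y) = b (sigma y)) -> b x = f 1 ->
    b (f 1) != f 2 -> b (f 2) != f 3 ->
  3 %| size s.
Proof.
move=> bs b0 b1 b2; rewrite /dvdn.
have bsk k y : (sigma ^+ k)%g (b y) = b ((sigma ^+ k)%g y).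
  by elim: k y => [|k IH] y; rewrite ?expg0 ?perm1 // expgS !permM bs IH.
have : size s %% 3 < 3 by rewrite ltn_pmod.
have nE : size s = 3 * (size s %/ 3) + size s %% 3 by lia.
have : b (f (size s %% 3)) = f (size s %% 3).+1.
  apply: (@perm_inj _ (sigma ^+ (size s %/ 3))%g).
  rewrite bsk !shift_power addnS -nE.
  by have := iter_next_size 0; have := iter_next_size 1; rewrite addn1 addn0 => -> ->.
case: (size s %% 3) => [|[|[|]]] // E _.
  by case/eqP: b1.
by case/eqP: b2.
Qed.

(** The power of [sigma] by a third of [size s] is a full turn, hence trivial by the second
    hypothesis; a smaller order would bring [x] back before a full turn. *)
Lemma shift_order : 3 %| size s ->
    (forall k, {in s, (sigma ^+ k)%g =1 id} -> (sigma ^+ k)%g = 1%g) ->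
  size s = 3 * #[sigma]%g.
Proof.
move=> n3 sigma1; pose k := size s %/ 3.
have nE : size s = 3 * k by rewrite /k; lia.
have s_gt0 : 0 < size s by case: (s) xs.
have : #[sigma]%g %| k.
  rewrite order_dvdn sigma1 // => y ys; have [j ->] := cycle_iter_next us xs ys.
  by rewrite shift_power -nE iter_next_size.
have k_gt0 : 0 < k by lia.
move=> /(dvdn_leq k_gt0) lk; rewrite nE; congr (3 * _).
apply/eqP; rewrite eqn_leq lk andbT leqNgt; apply/negP => kl.
have l_gt0 := order_gt0 sigma.
have /findex_iter : 3 * #[sigma]%g < fingraph.order (next s) x.
  by rewrite (order_cycle (cycle_next us) us xs); lia.
rewrite -[3 * _]addn0 -shift_power expg_order perm1 findex0; lia.
Qed.

(** Every position is 3i + j with j < 3, so the translates of [x], [f 1], [f 2] by powers of [sigma]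
    run through [s] exactly once. *)
Lemma alpha_rot : size s = 3 * #[sigma] ->
  exists i, alpha sigma x [:: f 1; f 2; f 3] = rot i s.
Proof.
move=> sz.
have supp : alpha_support sigma x [:: f 1; f 2; f 3] = [set y in s].
  apply/setP => z; rewrite inE; apply/imset2P/idP => [[i w _ wp ->]|zs].
    suff [j ->] : exists j, w = f j by rewrite shift_power mem_iter_next.
    by move: wp; rewrite /= !inE => /or3P[]/eqP->; [exists 0 | exists 1 | exists 2].
  have [j ->] := cycle_iter_next us xs zs.
  exists (Ordinal (ltn_pmod (j %/ 3) (order_gt0 sigma))) (f (j %% 3)) => //.
    have: j %% 3 < 3 by rewrite ltn_pmod.
    by case: (j %% 3) => [|[|[|]]] //; rewrite /= !inE eqxx ?orbT.
  by rewrite /= expg_mod_order shift_power; congr iter; lia.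
have flat m l : flatten [seq [seq (sigma ^+ i)%g y | y <- [:: x; f 1; f 2]]
    | i <- iota m l] = traject (next s) (f (3 * m)) (3 * l).
  elim: l m => [|l IH] m; first by rewrite muln0.
  have blk : [seq (sigma ^+ m)%g y | y <- [:: x; f 1; f 2]] =
      [:: f (3 * m); f (3 * m).+1; f (3 * m).+2].
    have := shift_power m 0; have := shift_power m 1; have := shift_power m 2.
    by rewrite !addnS !addn0 /= => -> -> ->.
  transitivity ([:: f (3 * m); f (3 * m).+1; f (3 * m).+2]
    ++ traject (next s) (f (3 * m.+1)) (3 * l)); first by rewrite -blk -IH.
  by rewrite !mulnS.
rewrite /alpha supp cardsE (card_uniqP us) sz eqxx flat muln1.
(* The exponents in [alpha] start at 1, so the sequence begins with [sigma x], which is [f 3]. *)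
have [i s' si] := rot_to (mem_iter_next 3); exists i; rewrite si.
have rots : fcycle (next s) (f 3 :: s') by rewrite -si rot_cycle cycle_next.
have : (size s').+1 = size s by rewrite -(size_rot i s) si.
rewrite sz => <-; rewrite trajectS; congr cons.
move: rots => /= /fpathP[m ms]; have := congr1 size ms.
rewrite size_rcons size_traject => sm; move: ms.
by rewrite -sm trajectSr; case/rcons_inj.
Qed.

End Shift.

End CyclicSequences.

(** Incidences between nodes and members of [E] are counted in two ways. *)
Lemma double_count (T : finType) (E : {set {set T}}) k :
    (forall a, a \in E -> #|a| = 2) ->
    (forall x, #|[set a in E | x \in a]| = k) ->
  2 * #|E| = k * #|T|.
Proof.
move=> E2 Ek.
have -> : 2 * #|E| = \sum_(a in E) #|a|.
  by rewrite (eq_bigr (fun=> 2)) // sum_nat_const mulnC.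
have -> : k * #|T| = \sum_(x : T) \sum_(a in E | x \in a) 1.
  rewrite (eq_bigr (fun=> k)) ?sum_nat_const 1?mulnC // => x _.
  by rewrite sum1_card -(Ek x); apply: eq_card => a; rewrite !inE.
rewrite (exchange_big_dep (mem E)) /=; last by move=> x a _ /andP[].
by apply: eq_bigr => a aE; rewrite -sum1_card; apply: eq_bigl => x; rewrite aE.
Qed.

Lemma arcsP (T : finType) (e : rel T) a :
  reflect (exists x y, e x y /\ a = [set x; y]) (a \in arcs e).
Proof.
apply: (iffP imset2P) => [[x y _ exy ->]|[x [y [exy ->]]]]; first by exists x, y.
by exists x y.
Qed.

(** * Faces, their opposite edges and the face graph *)

Section Surface.

Variables (P : finType) (X : {set {set P}}).
Hypothesis surfX : simplicial_surface X.

Local Notation T := (face X).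
Local Notation A := (autX X).
Local Notation e := (@face_graph P X).
Local Notation lam := (lambda X).
Implicit Types (F G : T) (v w x y : P) (g : {perm P}) (u : seq T).

Lemma card_face F : #|val F| = 3.
Proof. by have := valP F; rewrite inE => /andP[_ /eqP]. Qed.

Lemma face_in F : val F \in X.
Proof. by have := valP F; rewrite inE => /andP[]. Qed.

Lemma simplex_sub (B C : {set P}) : B \in X -> C \subset B -> C \in X.
Proof. by have [[_ sub] _ _ _ _] := surfX; apply: sub. Qed.

Lemma face_vertex F v : v \in val F -> v \in vertices X.
Proof. by move=> vF; rewrite inE (simplex_sub (face_in F)) ?sub1set. Qed.

Lemma vertex_face v : v \in vertices X -> exists F, v \in val F.
Proof.
rewrite inE => vX; have [_ maxX _ _ _] := surfX.
have [B maxB vB] := @maxset_exists P (mem X) _ vX.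
have FB : B \in simplices X 2.
  by rewrite inE (maxX _ maxB) andbT; apply: maxsetp maxB.
by exists (Sub B FB); rewrite SubK -sub1set.
Qed.

Lemma face_exists : exists F : T, true.
Proof.
have [[/set0Pn[B BX] _] maxX _ _ _] := surfX.
have [C maxC _] := @maxset_exists P (mem X) _ BX.
have FC : C \in simplices X 2.
  by rewrite inE (maxX _ maxC) andbT; apply: maxsetp maxC.
by exists (Sub C FC).
Qed.

(** The face across the edge of [F] opposite [v]. For [v] in [F] the default never arises, since
    each edge lies in exactly two faces. *)
Definition opp F v : T :=
  odflt F [pick G | (G != F) && (val F :\ v \subset val G)].

Lemma card_edge F v : v \in val F -> #|val F :\ v| = 2.
Proof. by move=> vF; have := cardsD1 v (val F); rewrite vF card_face; lia. Qed.

Lemma opp_spec F v : v \in val F ->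
  [/\ opp F v != F, val F :\ v \subset val (opp F v)
    & forall G, G != F -> val F :\ v \subset val G -> G = opp F v].
Proof.
move=> vF; have [_ _ edgeX _ _] := surfX.
have BE : val F :\ v \in simplices X 1.
  by rewrite inE card_edge // eqxx (simplex_sub (face_in F)) ?subD1set.
have := edgeX _ BE; set S := [set _ in _ | _] => S2.
have FS : val F \in S by rewrite inE (valP F) subD1set.
have : #|S :\ val F| == 1 by have := cardsD1 (val F) S; rewrite FS S2 add1n => -[<-].
case/cards1P => B SB.
have : B \in S :\ val F by rewrite SB set11.
rewrite !inE => /andP[BF /andP[/andP[BX B3] FB]].
have BT : B \in simplices X 2 by rewrite inE BX.
have uniqB G : G != F -> val F :\ v \subset val G -> val G = B.
  move=> GF FG; apply/set1P; rewrite -SB 3!inE FG (valP G).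
  by rewrite -val_eqE in GF; rewrite GF.
rewrite /opp; case: pickP => [G /andP[GF FG]|/(_ (Sub B BT))] /=.
  split; [exact: GF | exact: FG | move=> G' G'F FG'].
  by apply: val_inj; rewrite (uniqB _ GF FG) (uniqB _ G'F FG').
by rewrite -val_eqE /= BF FB.
Qed.

Lemma opp_neq F v : v \in val F -> opp F v != F.
Proof. by case/opp_spec. Qed.

Lemma opp_unique F G v : v \in val F -> G != F -> val F :\ v \subset val G ->
  G = opp F v.
Proof. by case/opp_spec => _ _; apply. Qed.

Lemma face_inter_lt F G : F != G -> #|val F :&: val G| <= 2.
Proof.
move=> FG; rewrite -ltnS -(card_face F) proper_card // properEneq subsetIl andbT.
apply: contraNneq FG => /setIidPl FG; apply/eqP/val_inj/eqP.
by rewrite eqEcard FG !card_face.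
Qed.

Lemma opp_inter F v : v \in val F -> val F :&: val (opp F v) = val F :\ v.
Proof.
move=> vF; have [neq sub _] := opp_spec vF.
apply/esym/eqP; rewrite eqEcard subsetI subD1set sub card_edge //.
by rewrite face_inter_lt // eq_sym.
Qed.

Lemma in_opp F v x : v \in val F -> x \in val F ->
  (x \in val (opp F v)) = (x != v).
Proof.
move=> vF xF; have /setP/(_ x) := opp_inter vF.
by rewrite !inE xF andbT.
Qed.

Lemma opp_inj F : {in val F &, injective (opp F)}.
Proof.
move=> v x vF xF E; apply/eqP; have := in_opp vF xF.
by rewrite E in_opp // eqxx eq_sym => /esym/negbFE.
Qed.

Lemma face_graphE F G : e F G = (#|val F :&: val G| == 2).
Proof.
apply/andP/idP => [[FG /existsP[B /andP[]]]|FG2].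
  rewrite inE => /andP[BX /eqP B2] /andP[BF BG].
  have := @subset_leq_card _ (mem B) (mem (val F :&: val G)).
  by rewrite subsetI BF BG B2 eqn_leq face_inter_lt // => ->.
split; first by apply: contraTneq FG2 => ->; rewrite setIid card_face.
apply/existsP; exists (val F :&: val G); rewrite subsetIl subsetIr !andbT.
by rewrite inE FG2 andbT (simplex_sub (face_in F)) ?subsetIl.
Qed.

Lemma face_graph_sym : symmetric e.
Proof. by move=> F G; rewrite !face_graphE setIC. Qed.

Lemma face_graph_irr F : e F F = false.
Proof. by rewrite /face_graph eqxx. Qed.

Lemma face_graph_opp F v : v \in val F -> e F (opp F v).
Proof. by move=> vF; rewrite face_graphE opp_inter // card_edge. Qed.

(** Adjacent faces share two vertices, so exactly one vertex of [F] is missing from [G], and [G]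
    lies across the edge opposite to it. *)
Lemma face_graphP F G : reflect (exists2 v, v \in val F & G = opp F v) (e F G).
Proof.
apply: (iffP idP) => [eFG|[v vF ->]]; last exact: face_graph_opp.
have := eFG; rewrite face_graphE => /eqP FG2.
have : #|val F :\: val G| == 1.
  by have := cardsID (val G) (val F); rewrite FG2 card_face; lia.
case/cards1P => v FGv.
have : v \in val F :\: val G by rewrite FGv set11.
rewrite inE => /andP[vG vF]; exists v => //; apply: opp_unique => //.
  by apply: contraTneq eFG => ->; rewrite face_graph_irr.
apply/subsetP => x; rewrite 2!inE => /andP[xv xF].
apply: contraNT xv => xG; rewrite -in_set1 -FGv inE xG xF.
by [].
Qed.

Lemma opp_opp F v x : v \in val F -> x \in val (opp F v) -> x \notin val F ->
  opp (opp F v) x = F.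
Proof.
move=> vF xG xF; apply/esym/opp_unique => //; first by rewrite eq_sym opp_neq.
have GF : val (opp F v) :&: val F = val (opp F v) :\ x.
  apply/eqP; rewrite eqEcard card_edge // setIC opp_inter // card_edge //.
  rewrite leqnn andbT; apply/subsetP => y; rewrite !inE => /andP[yv yF].
  by rewrite in_opp // yv andbT; apply: contraNneq xF => <-.
by rewrite -GF subsetIr.
Qed.

Lemma face_graph_opp_sym F G : e F G -> exists2 w, w \in val G & F = opp G w.
Proof. by rewrite face_graph_sym => /face_graphP. Qed.

Lemma face3 F a b c x : a \in val F -> b \in val F -> c \in val F ->
  a != b -> a != c -> b != c -> x \in val F -> [|| x == a, x == b | x == c].
Proof.
move=> aF bF cF ab ac bc xF.
have : [set a; b; c] == val F.
  rewrite eqEcard card_face; apply/andP; split.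
    by apply/subsetP => y; rewrite !inE => /orP[/orP[]|] /eqP->.
  by rewrite setUC cardsU1 cards2 !inE ab (eq_sym c) (eq_sym c) negb_or ac bc.
by move/eqP/setP/(_ x); rewrite !inE xF orbA.
Qed.

Lemma edge_elems F v : v \in val F ->
  exists x y, [/\ x \in val F, y \in val F, x != v, y != v & x != y].
Proof.
move=> vF; have /eqP/cards2P[x [y [xy E]]] := card_edge vF.
have : x \in val F :\ v by rewrite E !inE eqxx.
have : y \in val F :\ v by rewrite E !inE eqxx orbT.
by rewrite !inE => /andP[yv yF] /andP[xv xF]; exists x, y.
Qed.

(** If [w] differed from [v], the face across the edge opposite [w] would contain [v] but not
    [w]. *)
Lemma vertex_eq v w : v \in vertices X ->
  (forall F, v \in val F -> w \in val F) -> v = w.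
Proof.
move=> /vertex_face[F vF] vw; have wF := vw _ vF.
apply/eqP; apply: contraT => neq_vw; have := vw (opp F w).
by rewrite !in_opp // neq_vw eqxx => /(_ isT).
Qed.

(** * Action of the automorphism group *)

Lemma autX_faces g : g \in A -> g \in 'N(simplices X 2 | 'P^*).
Proof. by case/setIP. Qed.

Lemma autX_dom : A \subset 'dom lam.
Proof.
(* The domain of the action on faces is the normaliser of this comprehension, which agrees with
   [simplices X 2] only extensionally. *)
have SE : simplices X 2 = [set B | B \in simplices X 2].
  by apply/setP => B; rewrite inE.
apply/subsetP => g /autX_faces; have := congr1 (fun S => g \in 'N(S | 'P^*)) SE.
by rewrite /= => ->.
Qed.

Lemma val_lam g F : g \in A -> val (lam g F) = [set g x | x in val F].
Proof.
move=> gA; have gD := subsetP autX_dom _ gA.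
by rewrite /= actpermE /= val_subact gD.
Qed.

Lemma mem_lam g F x : g \in A -> (g x \in val (lam g F)) = (x \in val F).
Proof. by move=> gA; rewrite val_lam // mem_imset //; apply: perm_inj. Qed.

Lemma lamM g h : g \in A -> h \in A -> lam (g * h)%g = (lam g * lam h)%g.
Proof. by move=> gA hA; rewrite morphM //; apply: (subsetP autX_dom). Qed.

Lemma lamX g n : g \in A -> lam (g ^+ n)%g = (lam g ^+ n)%g.
Proof. by move=> gA; rewrite morphX //; apply: (subsetP autX_dom). Qed.

Lemma lamMx g h F : g \in A -> h \in A -> lam (g * h)%g F = lam h (lam g F).
Proof. by move=> gA hA; rewrite lamM // permM. Qed.

Lemma lamVK g F : g \in A -> lam g^-1%g (lam g F) = F.
Proof. by move=> gA; rewrite -lamMx ?groupV // mulgV morph1 perm1. Qed.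

Lemma lamKV g F : g \in A -> lam g (lam g^-1%g F) = F.
Proof. by move=> gA; rewrite -lamMx ?groupV // mulVg morph1 perm1. Qed.

Lemma lamP h : reflect (exists2 g, g \in A & h = lam g) (h \in lam @* A).
Proof.
apply: (iffP morphimP) => [[g _ gA ->]|[g gA ->]]; exists g => //.
exact: (subsetP autX_dom).
Qed.

Lemma lam_opp g F v : g \in A -> v \in val F ->
  lam g (opp F v) = opp (lam g F) (g v).
Proof.
move=> gA vF; have [neq sub _] := opp_spec vF; apply: opp_unique.
- by rewrite mem_lam.
- by rewrite (inj_eq perm_inj).
apply/subsetP => y; rewrite -[y](permKV g) !inE !mem_lam //.
rewrite (inj_eq perm_inj) => yF; apply: (subsetP sub); by rewrite !inE.
Qed.

Lemma lam_face_graph g F G : g \in A -> e (lam g F) (lam g G) = e F G.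
Proof.
move=> gA; rewrite !face_graphE !val_lam // -imsetI => [|x y _ _]; last first.
  exact: perm_inj.
by rewrite card_imset //; apply: perm_inj.
Qed.

Lemma aut_vertex g v : g \in A -> v \in vertices X -> g v \in vertices X.
Proof.
move=> gA /vertex_face[F vF]; apply: (@face_vertex (lam g F)).
by rewrite mem_lam.
Qed.

Lemma fix_faces_vertex g F v : g \in A -> v \in val F -> lam g F = F ->
  lam g (opp F v) = opp F v -> g v = v.
Proof.
move=> gA vF gF gO; apply: (@opp_inj F) => //; first by rewrite -{1}gF mem_lam.
by rewrite -[in LHS]gF -lam_opp.
Qed.

(** Rigidity: being fixed pointwise passes from a face to each adjacent one, hence to all faces by
    strong connectedness; off the vertices [g] is the identity by the definition of [autX]. *)
Lemma fix_face_eq1 g F : g \in A -> {in val F, forall x, g x = x} -> g = 1%g.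
Proof.
move=> gA gF; have [_ _ _ _ conn] := surfX.
have fixT G : {in val G, forall x, g x = x}.
  have /connectP[p + ->] := conn F G.
  elim: p F gF => //= G' p IH F' gF' /andP[/face_graphP[v vF ->]].
  apply: IH => x xG.
  have gid : lam g F' = F'.
    apply: val_inj; rewrite val_lam //; apply/setP => y; apply/imsetP/idP.
      by case=> z zF ->; rewrite gF'.
    by move=> yF; exists y; rewrite ?gF'.
  have [xF|xF] := boolP (x \in val F'); first exact: gF'.
  have gO : lam g (opp F' v) = opp F' v by rewrite lam_opp // gid gF'.
  (* The new vertex [x] is fixed because the new face and the face [F'] across its edge opposite [x]
     are both fixed. *)
  apply: (@fix_faces_vertex g (opp F' v)) => //; by rewrite opp_opp.
apply/permP => x; rewrite perm1; have [/vertex_face[G]|xX] := boolP (x \in vertices X).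
  exact: fixT.
by move: gA => /setIP[]; rewrite inE => /out_perm/(_ xX).
Qed.

Lemma lam_eq1 g : g \in A -> lam g = 1%g -> g = 1%g.
Proof.
move=> gA lg; have gid F : lam g F = F by rewrite lg perm1.
have [F _] := face_exists; apply: (fix_face_eq1 gA (F := F)) => x xF.
exact: (fix_faces_vertex gA xF).
Qed.

Lemma card_lam : #|lam @* A| = #|A|.
Proof.
rewrite (morphimEsub _ autX_dom) card_in_imset // => g h gA hA E.
apply/eqP; rewrite eq_mulgV1; apply/eqP/lam_eq1; first by rewrite groupM ?groupV.
by apply/permP => F; rewrite lamMx ?groupV // E lamVK // perm1.
Qed.

(** * Umbrellas *)

Lemma umbrella_cycle v u : umbrella v u -> path.cycle e u.
Proof. by case=> _ _; rewrite (@eq_cycle _ _ e) // => F G; rewrite face_graphE. Qed.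

Lemma umbrella_exists v : v \in vertices X -> exists u, @umbrella P X v u.
Proof. by have [_ _ _ umb _] := surfX; apply: umb. Qed.

Lemma umbrella_size v u : v \in vertices X -> umbrella v u -> 2 < size u.
Proof.
case/vertex_face=> F vF [uu mu _].
have [x [y [xF yF xv yv xy]]] := edge_elems vF.
apply: (@uniq_leq_size _ [:: F; opp F x; opp F y]) => [|G].
  have nxy : opp F x != opp F y by apply: contra xy => /eqP/opp_inj->.
  by rewrite /= !inE nxy negb_or ![F == opp F _]eq_sym (opp_neq xF) (opp_neq yF).
by rewrite !inE mu => /or3P[]/eqP-> //; rewrite in_opp // eq_sym.
Qed.

(** Of the three neighbours of [F], the one across the edge opposite [v] misses [v], so at most two
    lie in the umbrella. *)
Lemma umbrella_adj v u F G : v \in vertices X -> umbrella v u ->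
  F \in u -> G \in u -> e F G -> G = next u F \/ G = prev u F.
Proof.
move=> vX umb Fu Gu; have u_gt2 := umbrella_size vX umb.
have cu := umbrella_cycle umb; have [uu mu _] := umb.
have vF : v \in val F by rewrite -mu.
have [x [y [xF yF xv yv xy]]] := edge_elems vF.
have nb G' : G' \in u -> e F G' -> G' \in [set opp F x; opp F y].
  rewrite mu => + /face_graphP[w wF GE]; rewrite GE in_opp // !inE => vw.
  have [vx vy] : v != x /\ v != y by rewrite !(eq_sym v).
  have /or3P[/eqP wv|/eqP->|/eqP->] := face3 vF xF yF vx vy xy wF.
  - by rewrite wv eqxx in vw.
  - by rewrite eqxx.
  - by rewrite eqxx orbT.
have N2 : #|[set opp F x; opp F y]| <= 2 by rewrite cards2; case: eqP.
exact: (cycle_neighbours face_graph_sym uu u_gt2 cu N2 nb Fu Gu).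
Qed.

Lemma umbrella_equiv v u t : v \in vertices X -> umbrella v u -> umbrella v t ->
  cyc_equiv u t.
Proof.
move=> vX umb umbt; have [uu mu _] := umb; have [ut mt _] := umbt.
apply: cyc_equiv_cycle => //; first exact: umbrella_size umbt.
  by move=> F; rewrite mu mt.
move=> F Fu; have Ft : F \in t by rewrite mt -mu.
apply: (umbrella_adj vX umb Fu); first by rewrite mu -mt mem_next.
exact: (next_cycle (umbrella_cycle umbt)).
Qed.

Lemma equiv_umbrella v u t : umbrella v u -> cyc_equiv u t -> umbrella v t.
Proof.
case=> uu mu cu /cyc_equivP[i _ [] ->]; split.
- by rewrite rot_uniq.
- by move=> F; rewrite mem_rot.
- by rewrite rot_cycle.
- by rewrite rev_uniq rot_uniq.
- by move=> F; rewrite mem_rev mem_rot.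
by apply: rel_cycle_rev; [move=> F G; rewrite setIC | rewrite rot_cycle].
Qed.

(** The class of the umbrella of [v], described without choosing a representative, so that it
    visibly depends on [v] alone. *)
Definition umbrellas v : gcycle T :=
  [set t : {bseq #|T| of T} |
    [&& uniq t, [forall F, (F \in val t) == (v \in val F)] & path.cycle e t]].

Lemma umbrellasP v (t : {bseq #|T| of T}) :
  reflect (umbrella v (val t)) (t \in umbrellas v).
Proof.
rewrite inE (@eq_cycle _ e (fun F G : T => #|val F :&: val G| == 2)); last first.
  by move=> F G; rewrite face_graphE.
apply: (iffP and3P) => -[ut mt ct]; split; [exact: ut | | exact: ct
  | exact: ut | | exact: ct].
  by move=> F; apply/eqP; move/forallP: mt.
by apply/forallP => F; apply/eqP.
Qed.

Lemma umbrella_bseq v u : umbrella v u ->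
  exists2 t : {bseq #|T| of T}, t \in umbrellas v & val t = u.
Proof.
move=> umb; have [uu _ _] := umb.
have su : size u <= #|T| by rewrite -(card_uniqP uu) max_card.
by exists (Bseq su) => //; apply/umbrellasP.
Qed.

Lemma cycle_class_umbrella v u : v \in vertices X -> umbrella v u ->
  cycle_class u = umbrellas v.
Proof.
move=> vX umb; apply/setP => t; rewrite inE; apply/idP/umbrellasP.
  exact: equiv_umbrella.
exact: umbrella_equiv.
Qed.

Lemma umbrellas_nodes v : v \in vertices X ->
  cycle_nodes (umbrellas v) = [set F : T | v \in val F].
Proof.
move=> vX; apply/setP => F; rewrite !inE; apply/existsP/idP.
  by case=> t /andP[/umbrellasP[_ mt _]]; rewrite mt.
have [u /umbrella_bseq[t tv _]] := umbrella_exists vX.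
by move=> vF; exists t; have /umbrellasP[_ -> _] := tv; rewrite tv.
Qed.

Lemma umbrellas_arcs v (a : {set T}) : v \in vertices X -> reflect
  (exists F G, [/\ a = [set F; G], e F G, v \in val F & v \in val G])
  (a \in cycle_arcs (umbrellas v)).
Proof.
move=> vX; apply: (iffP bigcupP) => [[t /umbrellasP umb /imsetP[F Ft ->]]|].
  have [ut mt _] := umb; exists F, (next (val t) F).
  by rewrite -!mt mem_next (next_cycle (umbrella_cycle umb)).
case=> F [G [-> eFG vF vG]].
have [u /umbrella_bseq[t tv _]] := umbrella_exists vX.
exists t => //; have umb := umbrellasP _ _ tv; have [ut mt _] := umb.
have [Ft Gt] : F \in val t /\ G \in val t by rewrite !mt.
case: (umbrella_adj vX umb Ft Gt eFG) => ->; apply/imsetP.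
  by exists F; first exact: Ft.
exists (prev (val t) F); first by rewrite (mem_prev (val t)); exact: Ft.
by rewrite (next_prev ut) setUC.
Qed.

Lemma umbrellas_inj : {in vertices X &, injective umbrellas}.
Proof.
move=> v w vX wX E; apply: vertex_eq => // F vF.
have : F \in cycle_nodes (umbrellas w) by rewrite -E umbrellas_nodes // inE.
by rewrite umbrellas_nodes // inE.
Qed.

Lemma umbrella_is_cycle v u : v \in vertices X -> umbrella v u -> is_cycle e u.
Proof.
move=> vX umb; have [uu _ _] := umb.
by rewrite /is_cycle (umbrella_size vX umb) uu (umbrella_cycle umb).
Qed.

Lemma lam_umbrella g v u : g \in A -> umbrella v u ->
  umbrella (g v) [seq lam g F | F <- u].
Proof.
move=> gA umb; have [uu mu _] := umb; split.
- by rewrite map_inj_uniq //; apply: perm_inj.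
- move=> F; rewrite -[F](lamKV _ gA) mem_map; last exact: perm_inj.
  by rewrite mem_lam.
rewrite (@eq_cycle _ _ e); last by move=> F G; rewrite face_graphE.
rewrite (mono_cycle (fun F G => lam_face_graph F G gA)); exact: umbrella_cycle umb.
Qed.


(** * The umbrellas as a vertex-faithful cycle double cover *)

Definition umbrella_cover : {set gcycle T} := [set umbrellas v | v in vertices X].

(** The umbrellas through an arc are those of the two vertices of the edge shared by its faces. *)
Lemma umbrella_cover_double : cycle_double_cover e umbrella_cover.
Proof.
split=> [c /imsetP[v vX ->]|_ /arcsP[F [G [eFG ->]]]].
  have [u umb] := umbrella_exists vX; exists u; first exact: umbrella_is_cycle umb.
  by rewrite (cycle_class_umbrella vX umb).
have vFG v : v \in val F :&: val G -> v \in vertices X.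
  by case/setIP => /face_vertex.
have -> : [set c in umbrella_cover | [set F; G] \in cycle_arcs c] =
    [set umbrellas v | v in val F :&: val G].
  apply/setP => c; rewrite in_set; apply/andP/imsetP => [[/imsetP[v vX ->]]|[v vI ->]].
    case/(umbrellas_arcs _ vX) => F' [G' [E _ vF' vG']]; exists v => //.
    have in_arc K : K \in [set F; G] -> v \in val K by rewrite E => /set2P[]->.
    by rewrite inE !in_arc ?inE ?eqxx ?orbT.
  have vX := vFG v vI; split; first exact: imset_f.
  have /setIP[vF vG] := vI; apply/(umbrellas_arcs _ vX); by exists F, G.
rewrite card_in_imset; first by move: eFG; rewrite face_graphE => /eqP.
by move=> v w /vFG vX /vFG wX; apply: umbrellas_inj.
Qed.

Lemma two_faces F G F' v w : e F G -> v != w -> v \in val F -> v \in val G ->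
  w \in val F -> w \in val G -> v \in val F' -> w \in val F' ->
  F' \in [set F; G].
Proof.
move=> eFG vw vF vG wF wG vF' wF'; apply/set2P.
have [->|F'F] := eqVneq F' F; [by left | right].
have /face_graphP[z zF GE] := eFG; rewrite GE; apply: opp_unique => //.
have <- : [set v; w] = val F :\ z.
  apply/eqP; rewrite eqEcard cards2 vw card_edge // leqnn andbT.
  by rewrite -opp_inter // -GE; apply/subsetP => x /set2P[]->; rewrite inE ?vF ?wF.
by apply/subsetP => x /set2P[]->.
Qed.

(** An arc shared by the umbrellas of [v] and [w] must consist of the two faces on the edge joining
    [v] and [w], hence is unique. *)
Lemma umbrella_cover_faithful : vertex_faithful e umbrella_cover.
Proof.
split=> [c /imsetP[v vX ->] F G|c d /imsetP[v vX ->] /imsetP[w wX ->] cd].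
  rewrite !umbrellas_nodes // !in_set => vF vG eFG.
  by apply/(umbrellas_arcs _ vX); exists F, G.
have vw : v != w by apply: contraNneq cd => ->.
apply/card_le1_eqP => a b /setIP[av aw] /setIP[bv bw].
have sub a' b' : a' \in cycle_arcs (umbrellas v) -> a' \in cycle_arcs (umbrellas w) ->
    b' \in cycle_arcs (umbrellas v) -> b' \in cycle_arcs (umbrellas w) -> b' \subset a'.
  case/(umbrellas_arcs _ vX) => F [G [-> eFG vF vG]].
  case/(umbrellas_arcs _ wX) => F1 [G1 [E _ wF1 wG1]].
  have wFG K : K \in [set F; G] -> w \in val K by rewrite E => /set2P[]->.
  case/(umbrellas_arcs _ vX) => F' [G' [-> _ vF' vG']].
  case/(umbrellas_arcs _ wX) => F2 [G2 [E' _ wF2 wG2]].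
  have wFG' K : K \in [set F'; G'] -> w \in val K by rewrite E' => /set2P[]->.
  apply/subsetP => K KF'; apply: (@two_faces F G K v w) => //.
  - by apply: wFG; rewrite !inE eqxx.
  - by apply: wFG; rewrite !inE eqxx orbT.
  - by case/set2P: KF' => ->.
  - exact: wFG'.
by apply/eqP; rewrite eqEsubset !sub.
Qed.

Lemma umbrella_orbit v u :
    (forall v w, v \in vertices X -> w \in vertices X ->
       exists2 g, g \in A & g v = w) ->
    v \in vertices X -> umbrella v u ->
  Defs.cycle_orbit (lam @* A) u = umbrella_cover.
Proof.
move=> vtrX vX umb; apply/setP => c; apply/imsetP/imsetP => [[_ /lamP[g gA ->] ->]|].
  exists (g v); first exact: aut_vertex.
  by apply: cycle_class_umbrella; [exact: aut_vertex | exact: lam_umbrella].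
case=> w wX ->; have [g gA gv] := vtrX v w vX wX.
exists (lam g); first by apply/lamP; exists g.
by rewrite -gv (cycle_class_umbrella _ (lam_umbrella gA umb)) // aut_vertex.
Qed.

(* A vertex is recovered from the set of nodes of its umbrella, so two classes
   in one orbit come from vertices in one orbit. *)
Lemma orbit_vertices s v w u t : v \in vertices X ->
    umbrella v u -> umbrella w t ->
    cycle_class u \in Defs.cycle_orbit (lam @* A) s ->
    cycle_class t \in Defs.cycle_orbit (lam @* A) s ->
  exists2 g, g \in A & g v = w.
Proof.
move=> vX umb umbt /imsetP[_ /lamP[g gA ->] uE] /imsetP[_ /lamP[h hA ->] tE].
(* Rotation and reversal preserve the node set, so [s] consists of the faces that [k] moves onto
   faces containing [x]. *)
have nodes x r k : umbrella x r -> k \in A ->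
    cycle_class r = cycle_class [seq lam k F | F <- s] ->
    forall F, (F \in s) = (x \in val (lam k F)).
  move=> umbr kA rE F; have [ur mr _] := umbr.
  have [b _ bE] := umbrella_bseq umbr.
  have : b \in cycle_class r.
    by rewrite inE bE; apply/cyc_equivP; exists 0; rewrite ?rot0; auto.
  rewrite rE inE bE => /cyc_equivP[i _ rs].
  rewrite -mr; case: rs => ->; rewrite ?mem_rev mem_rot mem_map //; exact: perm_inj.
have nu := nodes _ _ _ umb gA uE; have nt := nodes _ _ _ umbt hA tE.
exists (g^-1 * h)%g; first by rewrite groupM ?groupV.
rewrite permM; apply/(canLR (permKV h)); apply: vertex_eq.
  by apply: aut_vertex; rewrite ?groupV.
move=> F vF; have gvF : v \in val (lam g F) by rewrite -[v](permKV g) mem_lam.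
by rewrite -(mem_lam _ _ hA) permKV -nt nu.
Qed.

(** * Face-transitive surfaces with face stabilisers of order two *)

Lemma setact_lam F g : g \in A -> ('P^*%act (val F) g == val F) = (lam g F == F).
Proof.
move=> gA; have E : 'P^*%act (val F) g = val (lam g F) by rewrite val_lam.
by rewrite E.
Qed.

Lemma card_faces : #|T| = #|simplices X 2|.
Proof. by rewrite card_sig; apply: eq_card => B. Qed.

(** The nontrivial element [t] of the stabiliser of [F] is an involution. By rigidity it moves a
    vertex of [F], so it swaps two vertices and fixes the third, the apex. *)
Lemma apex_exists :
    (forall B, B \in simplices X 2 -> #|'C_A[B | 'P^*]| = 2) ->
  exists apex : T -> P, [/\
    forall F, apex F \in val F,
    forall g F, g \in A -> apex (lam g F) = g (apex F) &
    forall F x y, x \in val F -> y \in val F -> x != apex F -> y != apex F ->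
      exists2 g, g \in A & lam g F = F /\ g x = y].
Proof.
move=> stab2.
pose fixed F z := forall g, g \in A -> lam g F = F -> g z = z.
pose moved F x := exists2 g, g \in A & lam g F = F /\ g x != x.
have /fin_all_exists[apex apexP] F :
    exists z, [/\ z \in val F, fixed F z & forall x, x \in val F -> x != z -> moved F x].
  have := stab2 _ (valP F); set S := 'C_A[_ | _] => S2.
  have memS g : (g \in S) = (g \in A) && (lam g F == F).
    rewrite inE; have [gA|//] := boolP (g \in A).
    by rewrite -setact_lam //; apply/astab1P/eqP.
  have S1 : 1%g \in S by rewrite memS group1 morph1 perm1 eqxx.
  have : #|S :\ 1%g| == 1 by have := cardsD1 1%g S; rewrite S1 S2 add1n => -[<-].
  case/cards1P => t St.
  have : t \in S :\ 1%g by rewrite St set11.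
  rewrite in_setD1 memS => /andP[t1] /andP[tA /eqP tF].
  have stabE g : g \in A -> lam g F = F -> g = 1%g \/ g = t.
    move=> gA gF; have [|g1] := eqVneq g 1%g; first by left.
    by right; apply/set1P; rewrite -St in_setD1 g1 memS gA gF eqxx.
  have tt x : t (t x) = x.
    have ttF : lam (t * t)%g F = F by rewrite lamMx // !tF.
    rewrite -permM; have [->|] := stabE _ (groupM tA tA) ttF; first by rewrite perm1.
    by move/(canRL (mulgK _)); rewrite mulgV => t1'; rewrite t1' eqxx in t1.
  have tin x : (t x \in val F) = (x \in val F) by rewrite -{1}tF mem_lam.
  have /existsP[x /andP[xF txx]] : [exists x in val F, t x != x].
    apply: contraNT t1 => /exists_inPn fixt.
    apply/eqP/(fix_face_eq1 tA (F := F)) => x xF; apply/eqP.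
    by have := fixt _ xF; rewrite negbK.
  have : #|val F :\ x :\ t x| == 1.
    have := cardsD1 (t x) (val F :\ x); rewrite !inE txx tin xF card_edge //; lia.
  case/cards1P => z zE.
  have : z \in val F :\ x :\ t x by rewrite zE set11.
  rewrite !inE => /and3P[ztx zx zF].
  have txF : t x \in val F by rewrite tin.
  have tz : t z = z.
    have : t z \in val F :\ x :\ t x.
      by rewrite !inE tin zF (inj_eq perm_inj) zx -{1}[x]tt (inj_eq perm_inj) ztx.
    by rewrite zE => /set1P.
  have xtx : x != t x by rewrite eq_sym.
  exists z; split => // [g gA gF | y yF yz].
    by have [->|->] := stabE g gA gF; rewrite ?perm1.
  exists t => //; split=> //.
  have [xz txz] : x != z /\ t x != z by rewrite !(eq_sym _ z).
  have /or3P[/eqP->|/eqP->|yz'] := face3 xF txF zF xtx xz txz yF.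
  - exact: txx.
  - by rewrite tt.
  - by rewrite yz' in yz.
(* Otherwise some [h] stabilising [lam g F] moves [g (apex F)], and its conjugate by [g] stabilises
   [F] but moves the apex. *)
have apex_lam g F : g \in A -> apex (lam g F) = g (apex F).
  move=> gA; apply/eqP; apply: contraT => ne.
  have [aF fixF _] := apexP F; have [_ _ movG] := apexP (lam g F).
  have gaF : g (apex F) \in val (lam g F) by rewrite mem_lam.
  have [|h hA [hG]] := movG _ gaF; first by rewrite eq_sym.
  have cA : (g * h * g^-1)%g \in A by rewrite !groupM ?groupV.
  have /(_ cA) := fixF (g * h * g^-1)%g.
  rewrite !lamMx ?groupM ?groupV // hG lamVK // => /(_ erefl).
  by rewrite !permM => /(canRL (permKV g)) ->; rewrite eqxx.
exists apex; split=> //; first by move=> F; case: (apexP F).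
move=> F x y xF yF xa ya; have [aF fixF movF] := apexP F.
have [->|xy] := eqVneq x y; first by exists 1%g; rewrite ?group1 // morph1 !perm1.
have [g gA [gF gx]] := movF x xF xa.
have gxF : g x \in val F by rewrite -gF mem_lam.
exists g => //; split=> //.
have [ax ay] : apex F != x /\ apex F != y by rewrite !(eq_sym (apex F)).
(* [g x] is neither [x] nor the apex, which [g] fixes, so only [y] remains. *)
have /or3P[/eqP|/eqP|/eqP] := face3 aF xF yF ax ay xy gxF.
- by rewrite -{1}(fixF g gA gF) => /perm_inj xE; rewrite xE eqxx in xa.
- by move=> xE; rewrite xE eqxx in gx.
- by [].
Qed.

(** * Crossing the base of a face *)

Section Transitive.

Hypothesis ftrX : face_transitive X.

Lemma face_trans F G : exists2 g, g \in A & lam g F = G.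
Proof.
have [g gA E] := atransP2 ftrX (valP F) (valP G).
by exists g => //; apply: val_inj; rewrite val_lam.
Qed.

Variable apex : T -> P.
Hypothesis apex_in : forall F, apex F \in val F.
Hypothesis apex_lam : forall g F, g \in A -> apex (lam g F) = g (apex F).
Hypothesis apex_base : forall F x y, x \in val F -> y \in val F ->
  x != apex F -> y != apex F -> exists2 g, g \in A & lam g F = F /\ g x = y.

Definition beta F := opp F (apex F).

Lemma in_beta F x : x \in val F -> (x \in val (beta F)) = (x != apex F).
Proof. exact: in_opp. Qed.

Lemma beta_lam g F : g \in A -> lam g (beta F) = beta (lam g F).
Proof. by move=> gA; rewrite lam_opp // -apex_lam. Qed.

(** Face-transitivity moves [F] to [G]; the stabiliser of [G] then corrects the base vertex. *)
Lemma base_trans F G x y : x \in val F -> y \in val G ->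
  x != apex F -> y != apex G -> exists2 g, g \in A & lam g F = G /\ g x = y.
Proof.
move=> xF yG xa ya; have [g gA gF] := face_trans F G.
have gxG : g x \in val G by rewrite -gF mem_lam.
have [|h hA [hG hx]] := apex_base gxG yG _ ya.
  by rewrite -gF apex_lam // (inj_eq perm_inj).
by exists (g * h)%g; rewrite ?groupM // lamMx // permM gF.
Qed.

(** [beta] commutes with a transitive group, so it is surjective, and injective by finiteness. *)
Lemma beta_inj : injective beta.
Proof.
apply/injectiveP; rewrite /injectiveb /dinjectiveb.
apply/card_uniqP; rewrite size_map -cardE.
apply: eq_card => G; rewrite inE; apply/imageP => /=.
have [F _] := face_exists; have [g gA <-] := face_trans (beta F) G.
by exists (lam g F) => //; rewrite beta_lam.
Qed.

(* If the base edge of F were a leg of beta F, the symmetry of beta F would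
   give a second face with the same image under beta. *)
Lemma betaK : involutive beta.
Proof.
move=> F; set G := beta F; have eFG : e F G by exact: face_graph_opp.
have [w wG FE] := face_graph_opp_sym eFG.
have [wa|wa] := eqVneq w (apex G); first by rewrite FE wa.
have [x [y [xG yG xa ya xy]]] := edge_elems (apex_in G).
(* [w'] is the base vertex of [G] other than [w]. *)
have [w' [w'G w'a ww']] : exists w', [/\ w' \in val G, w' != apex G & w' != w].
  have [xw|xw] := eqVneq x w; last by exists x.
  by exists y; rewrite yG ya -xw eq_sym.
have [g gA [gG gw]] := apex_base wG w'G wa w'a.
have gF : lam g F = F by apply: beta_inj; rewrite -beta_lam.
have : opp G w' = opp G w by rewrite -FE -gF FE lam_opp // gG gw.
by move/opp_inj => E; rewrite E ?eqxx in ww'.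
Qed.


(** * The two orbits of arcs *)

Local Notation H := (lam @* A)%G.

Definition base_arcs : {set {set T}} := [set [set F; beta F] | F in T].
Definition leg_arcs : {set {set T}} := arcs e :\: base_arcs.

Lemma beta_neq F : beta F != F.
Proof. exact: opp_neq. Qed.

Lemma beta_adj F : e F (beta F).
Proof. exact: face_graph_opp. Qed.

(** As [beta] is an involution, either end of a base arc may be taken as the face whose base is
    crossed. *)
Lemma mem_base_arcs F G : ([set F; G] \in base_arcs) = (G == beta F).
Proof.
apply/imsetP/eqP => [[K _ E]|->]; last by exists F.
have : F \in [set K; beta K] by rewrite -E !inE eqxx.
have : beta K \in [set F; G] by rewrite E !inE eqxx orbT.
have : K \in [set F; G] by rewrite E !inE eqxx.
move=> /set2P KFG /set2P bFG /set2P[FK|FK].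
  case: bFG => [bF|<-]; last by rewrite FK.
  by have := beta_neq K; rewrite bF FK eqxx.
case: KFG => [KF|<-]; last by rewrite FK betaK.
by have := beta_neq K; rewrite -FK KF eqxx.
Qed.

Lemma base_arc_card a : a \in base_arcs -> #|a| = 2.
Proof. by case/imsetP => F _ ->; rewrite cards2 eq_sym beta_neq. Qed.

Lemma mem_leg_arcs F G : ([set F; G] \in leg_arcs) = e F G && (G != beta F).
Proof.
rewrite inE mem_base_arcs andbC; congr andb.
apply/arcsP/idP => [[F' [G' [eFG E]]]|eFG]; last by exists F, G.
have FG' : F' != G' by apply: contraTneq eFG => ->; rewrite face_graph_irr.
have FG : F != G.
  apply: contraNneq FG' => FG; move: E; rewrite FG => /setP E.
  by have := E F'; have := E G'; rewrite !inE !eqxx orbT !orbb => /eqP-> /eqP->.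
have /set2P : F \in [set F'; G'] by rewrite -E !inE eqxx.
have /set2P : G \in [set F'; G'] by rewrite -E !inE eqxx orbT.
move=> [] GE [] FE; move: FG; rewrite GE FE ?eqxx // => _.
by rewrite face_graph_sym.
Qed.

Lemma leg_arcsP (a : {set T}) : reflect
  (exists F x, [/\ x \in val F, x != apex F & a = [set F; opp F x]])
  (a \in leg_arcs).
Proof.
apply: (iffP idP) => [aL|[F [x [xF xa ->]]]].
  have /setDP[/arcsP[F [G [eFG aE]]] _] := aL.
  move: aL; rewrite aE mem_leg_arcs => /andP[_ Gb].
  have /face_graphP[x xF GE] := eFG; exists F, x; split; rewrite ?GE //.
  by apply: contraNneq Gb => xa; rewrite GE xa.
rewrite mem_leg_arcs face_graph_opp //=; apply: contra xa => /eqP.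
by move/opp_inj => ->.
Qed.

Lemma setact_pair h F G : 'P^*%act [set F; G] h = [set h F; h G].
Proof. by rewrite /= /setact imsetU !imset_set1. Qed.

Lemma arc_orbit_base F : orbit 'P^* H [set F; beta F] = base_arcs.
Proof.
apply/setP => a; apply/orbitP/imsetP => [[_ /lamP[g gA ->] <-]|[G _ ->]].
  by exists (lam g F) => //; rewrite setact_pair beta_lam.
have [g gA gF] := face_trans F G; exists (lam g); first by apply/lamP; exists g.
by rewrite setact_pair beta_lam // gF.
Qed.

Lemma arc_orbit_leg F x : x \in val F -> x != apex F ->
  orbit 'P^* H [set F; opp F x] = leg_arcs.
Proof.
move=> xF xa; apply/setP => a; apply/orbitP/leg_arcsP.
  case=> _ /lamP[g gA ->] <-; exists (lam g F), (g x).
  by rewrite setact_pair lam_opp // mem_lam // apex_lam // (inj_eq perm_inj).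
case=> G [y [yG ya ->]]; have [g gA [gF gx]] := base_trans xF yG xa ya.
exists (lam g); first by apply/lamP; exists g.
by rewrite setact_pair lam_opp // gF gx.
Qed.

Lemma arc_orbits_surface : arc_orbits_12 e H leg_arcs base_arcs.
Proof.
have [F _] := face_exists; have aF := apex_in F.
have [x [y [xF yF xa ya xy]]] := edge_elems aF.
split.
- apply/setP => O; apply/imsetP/set2P => [[a aE ->]|].
    have [aB|aB] := boolP (a \in base_arcs).
      by right; have /imsetP[G _ ->] := aB; rewrite arc_orbit_base.
    left; have /leg_arcsP[G [z [zG za ->]]] : a \in leg_arcs by rewrite inE aB.
    by rewrite arc_orbit_leg.
  case=> ->.
    exists [set F; opp F x]; last by rewrite arc_orbit_leg.
    by apply/arcsP; exists F, (opp F x); rewrite face_graph_opp.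
  exists [set F; beta F]; last by rewrite arc_orbit_base.
  by apply/arcsP; exists F, (beta F); rewrite beta_adj.
- apply/eqP => /setP/(_ [set F; beta F]).
  by rewrite mem_base_arcs mem_leg_arcs eqxx andbF.
(* Both sides are doubled to match the incidence count: each face lies on two leg arcs, and below on
   one base arc. *)
- apply/eqP; rewrite -(eqn_pmul2l (ltn0Sn 1)); apply/eqP.
  apply: double_count => [a /leg_arcsP[G [z [zG _ ->]]]|G].
    by rewrite cards2 eq_sym opp_neq.
  have -> : [set a in leg_arcs | G \in a] =
      [set [set G; opp G z] | z in val G :\ apex G].
    apply/setP => a; rewrite inE; apply/andP/imsetP => [[aL Ga]|[z]].
      have /setDP[/arcsP[K [L [eKL aE]]] _] := aL.
      have [L' [eGL aE']] : exists L', e G L' /\ a = [set G; L'].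
        move: Ga; rewrite aE => /set2P[]->; first by exists L.
        by exists K; rewrite face_graph_sym setUC.
      have /face_graphP[z zG L'E] := eGL.
      move: aL; rewrite aE' mem_leg_arcs L'E => /andP[_ za].
      by exists z; rewrite // !inE zG andbT; apply: contraNneq za => ->.
    rewrite in_setD1 => /andP[za zG] ->; split; last by rewrite !inE eqxx.
    by apply/leg_arcsP; exists G, z.
  rewrite card_in_imset ?card_edge // => z w; rewrite !inE.
  move=> /andP[_ zG] /andP[_ wG] E.
  have : opp G z \in [set G; opp G w] by rewrite -E !inE eqxx orbT.
  by case/set2P=> [oz|/opp_inj->] //; have := opp_neq zG; rewrite oz eqxx.
rewrite -[RHS]mul1n; apply: double_count => [a|G]; first exact: base_arc_card.
suff -> : [set a in base_arcs | G \in a] = [set [set G; beta G]] by rewrite cards1.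
apply/setP => a; rewrite !inE; apply/andP/eqP => [[/imsetP[K _ ->]]|->].
  by case/set2P => ->; rewrite ?betaK // setUC.
by rewrite mem_base_arcs !inE !eqxx.
Qed.


(** * The period of an umbrella under vertex-transitivity *)

Hypothesis vtrX : forall v w, v \in vertices X -> w \in vertices X ->
  exists2 g, g \in A & g v = w.

(** Two adjacent faces with apex [v] would force [v] to be the apex of its whole umbrella, although
    [v], like every vertex, is a base vertex of some face. *)
Lemma apex_adj v u F G : umbrella v u -> F \in u -> G \in u -> e F G ->
  v = apex F -> v != apex G.
Proof.
move=> umb Fu Gu eFG vF; have [uu mu _] := umb; apply/eqP => vG.
have vinF : v \in val F by rewrite -mu.
have vX := face_vertex vinF.
(* An automorphism taking [F] to [K] fixes [v] and gives [K] a neighbour in the umbrella with apex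
   [v]; the stabiliser of [K] carries that neighbour to [next u K]. *)
have step K : K \in u -> v = apex K -> v = apex (next u K).
  move=> Ku vK; have vinK : v \in val K by rewrite -mu.
  have nu : next u K \in u by rewrite mem_next.
  have [g gA gF] := face_trans F K.
  have gv : g v = v by rewrite {1}vF -apex_lam // gF -vK.
  have gGu : v \in val (lam g G) by rewrite -{1}gv mem_lam // -mu.
  have /face_graphP[z zK gG] : e K (lam g G) by rewrite -gF lam_face_graph.
  have /face_graphP[z' z'K nK] := next_cycle (umbrella_cycle umb) Ku.
  have za : z != apex K by rewrite -vK eq_sym -(in_opp zK vinK) -gG.
  have z'a : z' != apex K by rewrite -vK eq_sym -(in_opp z'K vinK) -nK -mu.
  have [h hA [hK hz]] := apex_base zK z'K za z'a.
  have hv : h v = v by rewrite {1}vK -apex_lam // hK -vK.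
  by rewrite nK -hz -{1}hK -lam_opp // -gG !apex_lam // -vG gv hv.
have all_apex (K : T) : v \in val K -> v = apex K.
  rewrite -mu => Ku; have [i ->] := cycle_iter_next uu Fu Ku.
  have : iter i (next u) F \in u by elim: (i) => //= j; rewrite mem_next.
  elim: i => //= i IH; rewrite mem_next => iu; exact: step (IH iu).
have [x [y [xF _ xv _ _]]] := edge_elems vinF.
(* Moving a base vertex [x] of [F] to [v] yields a face containing [v] with another apex. *)
have [k kA kx] := vtrX (face_vertex xF) vX.
have : v = apex (lam k F) by apply: all_apex; rewrite -kx mem_lam.
by rewrite apex_lam // -kx => /perm_inj xa; rewrite xa vF eqxx in xv.
Qed.

(* Around a vertex v the umbrella repeats the pattern base, leg, leg of arcs,
   and the group contains the shift by one period. *)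
Lemma umbrella_shift : exists v u F g,
  [/\ v \in vertices X, umbrella v u, F \in u & g \in A] /\
  [/\ next u F = beta F, next u (next u F) != beta (next u F)
     & next u (next u (next u F)) != beta (next u (next u F))] /\
  [/\ lam g F = next u (next u (next u F)),
      {in u, forall K, lam g (next u K) = next u (lam g K)}
    & size u = 3 * #[lam g]%g].
Proof.
have [F2 _] := face_exists; have [v vE] : exists v, v = apex F2 by exists (apex F2).
have vF2 : v \in val F2 by rewrite vE.
have vX := face_vertex vF2.
have [u umb] := umbrella_exists vX; have [uu mu _] := umb.
have u_gt2 := umbrella_size vX umb; have cu := umbrella_cycle umb.
have F2u : F2 \in u by rewrite mu.
(* The window is centred at a face with apex [v]: [F0], [F1] will be joined by a base arc, and [F1],
   [F2], [F3] by leg arcs. *)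
pose F1 := prev u F2; pose F0 := prev u F1; pose F3 := next u F2.
have F1u : F1 \in u by rewrite mem_prev.
have F0u : F0 \in u by rewrite mem_prev.
have F3u : F3 \in u by rewrite mem_next.
have n0 : next u F0 = F1 by rewrite next_prev.
have n1 : next u F1 = F2 by rewrite next_prev.
have n2 : next u F2 = F3 := erefl.
have p1 : prev u F1 = F0 := erefl.
have p3 : prev u F3 = F2 by rewrite /F3 prev_next.
clearbody F1 F0 F3.
have vb2 : v \notin val (beta F2) by rewrite in_beta // vE eqxx.
have vF1 : v \in val F1 by rewrite -mu.
have vF3 : v \in val F3 by rewrite -mu.
have F12 : beta F1 != F2.
  by apply: contraNneq vb2 => <-; rewrite betaK.
have F32 : beta F3 != F2.
  by apply: contraNneq vb2 => <-; rewrite betaK.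
have va1 : v != apex F1.
  apply: (apex_adj umb F2u F1u) => //.
  by rewrite face_graph_sym -n1; exact: next_cycle cu F1u.
have va3 : v != apex F3.
  by apply: (apex_adj umb F2u F3u) => //; rewrite -n2; exact: next_cycle cu F2u.
have b1u : beta F1 \in u by rewrite mu in_beta.
have b3u : beta F3 \in u by rewrite mu in_beta.
(* [v] is a base vertex of [F1], so [beta F1] is one of its two neighbours in the umbrella, and it
   is not [F2]. *)
have b1 : beta F1 = F0.
  case: (umbrella_adj vX umb F1u b1u (beta_adj F1)) => E; last by rewrite E.
  by case/eqP: F12; rewrite E n1.
have b3 : beta F3 = next u F3.
  case: (umbrella_adj vX umb F3u b3u (beta_adj F3)) => E; first exact: E.
  by case/eqP: F32; rewrite E p3.
have b0 : beta F0 = F1 by rewrite -b1 betaK.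
have vF0 : v \in val F0 by rewrite -mu.
have va0 : v != apex F0 by rewrite -in_beta // b0 -mu.
(* [v] is a base vertex of both [F0] and [F3], so the shift can be chosen to fix [v]. *)
have [g gA [gF0 gv]] := base_trans vF0 vF3 va0 va3.
have [ut mt _] := lam_umbrella gA umb; rewrite gv in mt.
have umbt := lam_umbrella gA umb; rewrite gv in umbt.
have t_gt2 := umbrella_size vX umbt.
have ut_eq : u =i [seq lam g K | K <- u] by move=> K; rewrite mu mt.
have nt K : next [seq lam g K | K <- u] (lam g K) = lam g (next u K).
  by apply: next_map => //; apply: perm_inj.
have ntu : {in u, next [seq lam g K | K <- u] =1 next u}.
  apply: (next_propagate uu ut t_gt2 ut_eq _ F3u) => [K Ku|].
    have Kt : K \in [seq lam g K | K <- u] by rewrite -ut_eq.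
    apply: (umbrella_adj vX umb Ku); first by rewrite ut_eq mem_next.
    exact: (next_cycle (umbrella_cycle umbt) Kt).
  (* The base arc leaves both [F0] and [F3] in the forward direction, so [g] preserves the
     orientation of the umbrella. *)
  by rewrite -gF0 nt n0 gF0 -b3 -b0 beta_lam // gF0.
have lamu K : K \in u -> lam g K \in u by rewrite !mu -{2}gv mem_lam.
have comm : {in u, forall K, lam g (next u K) = next u (lam g K)}.
  by move=> K Ku; rewrite -nt ntu // lamu.
exists v, u, F0, g; split=> //; rewrite !n0 !n1 !n2; split; [split=> // | split=> //].
- by rewrite eq_sym.
- by apply: contraNneq vb2 => <-; rewrite -mu.
have gF0' : lam g F0 = iter 3 (next u) F0 by rewrite /= n0 n1 n2.
apply: (shift_order uu F0u comm gF0').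
  apply: (shift_dvd_size uu F0u comm gF0' (fun K => beta_lam K gA)).
  - by rewrite /= n0.
  - by rewrite /= n0 n1.
  - by rewrite /= n0 n1 n2; apply: contraNneq vb2 => ->.
(* A power fixing all faces of the umbrella fixes the apex [v] of [F2], and the other vertices of
   [F2] because the faces opposite them contain [v]. *)
move=> k fixu; rewrite -lamX //.
have gkA : (g ^+ k)%g \in A by rewrite groupX.
rewrite (fix_face_eq1 gkA (F := F2)) ?morph1 // => x xF.
have fixu' K : K \in u -> lam (g ^+ k)%g K = K by rewrite lamX //; apply: fixu.
have [->|xv] := eqVneq x v; first by rewrite vE -apex_lam // fixu'.
apply: (fix_faces_vertex gkA xF); rewrite fixu' //.
by rewrite mu in_opp // eq_sym.
Qed.


Lemma cover_12_surface : is_cover_12 e H umbrella_cover.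
Proof.
exists leg_arcs, base_arcs; split; first exact: arc_orbits_surface.
have [v [u [F [g [[vX umb Fu gA] [[n0 n1 n2] [gF comm sz]]]]]]] := umbrella_shift.
have [uu mu cu] := umb; have ce := umbrella_cycle umb.
have n1u : next u F \in u by rewrite mem_next.
have n2u : next u (next u F) \in u by rewrite mem_next.
(* The data are one period of the umbrella, read from its base arc, together with the shift by that
   period. *)
exists F, (next u F), (next u (next u F)), (lam g F), (lam g); split.
  split; first by rewrite mem_base_arcs n0.
    by rewrite mem_leg_arcs (next_cycle ce n1u).
  by rewrite mem_leg_arcs gF (next_cycle ce n2u).
split=> //.
- rewrite inE; apply/forallP => K; apply/forallP => L.
  by rewrite lam_face_graph.
- have [i aE] := alpha_rot uu Fu comm gF sz.
  rewrite gF aE; apply/esym/(umbrella_orbit vtrX vX).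
  split; first by rewrite rot_uniq.
    by move=> K; rewrite mem_rot.
  by rewrite rot_cycle.
- exact: umbrella_cover_double.
exact: umbrella_cover_faithful.
Qed.

End Transitive.

(** * Numerical invariants and transitivity on faces *)

Lemma vertex_transP : reflect
  (forall v w, v \in vertices X -> w \in vertices X ->
     exists2 g, g \in A & g v = w)
  (#|[set orbit 'P A v | v in vertices X]| == 1).
Proof.
apply: (iffP cards1P) => [[O OE] v w vX wX|tr].
  have inO z : z \in vertices X -> orbit 'P A z = O.
    by move=> zX; apply/set1P; rewrite -OE imset_f.
  have : w \in orbit 'P A v by rewrite inO // -(inO w) // orbit_refl.
  by case/orbitP => g gA <-; exists g.
have [F _] := face_exists; have /card_gt0P[x xF] : 0 < #|val F| by rewrite card_face.
have xX := face_vertex xF.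
exists (orbit 'P A x); apply/setP => O; rewrite inE; apply/imsetP/eqP => [[v vX ->]|->].
  have [g gA <-] := tr x v xX vX; apply/orbit_eqP.
  by apply/orbitP; exists g.
by exists x.
Qed.

Lemma lam_sub_aut : lam @* A \subset autG e.
Proof.
apply/subsetP => _ /lamP[g gA ->]; rewrite inE.
by apply/forallP => K; apply/forallP => L; rewrite lam_face_graph.
Qed.

Lemma lam_trans : face_transitive X -> [transitive lam @* A, on [set: T] | 'P].
Proof.
move=> ftrX; have [F _] := face_exists; apply/imsetP; exists F; rewrite ?inE //.
apply/setP => G; rewrite inE; apply/esym/orbitP.
have [g gA gF] := face_trans ftrX F G; exists (lam g) => //.
by apply/lamP; exists g.
Qed.

Lemma face_trans_lam :
  [transitive lam @* A, on [set: T] | 'P] -> face_transitive X.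
Proof.
move=> tr; have [F _] := face_exists; apply/imsetP; exists (val F); first exact: valP.
apply/setP => B; apply/idP/orbitP => [BX|[g gA <-]].
  have [] := atransP2 tr (in_setT F) (in_setT (Sub B BX : T)).
  move=> _ /lamP[g gA ->] E; exists g => //.
  have : val (lam g F) = B by have := congr1 val E => /= <-.
  by rewrite val_lam.
by have := valP (lam g F); rewrite val_lam.
Qed.

Lemma card_aut_face B : face_transitive X -> B \in simplices X 2 ->
  #|A| = #|T| * #|'C_A[B | 'P^*]|.
Proof.
by move=> ftrX BX; rewrite card_faces -(atransP ftrX _ BX) card_orbit_stab.
Qed.

End Surface.

Theorem theorem4p14 (P : finType) (X : {set {set P}}) :
  simplicial_surface X ->
  (face_transitive X /\ has_vf X 1 2) <->
  (let H := (lambda X @* autX X)%G in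
   group_12 (@face_graph P X) H /\
   exists C, is_cover_12 (@face_graph P X) H C /\
     forall (v : P) (u : seq (face X)),
       v \in vertices X -> umbrella v u -> cycle_class u \in C).
Proof.
move=> surfX; split=> [[ftr [orb1 stab2]]|[[_ tr cardH _] [C [covC umbC]]]].
  have vtr := vertex_transP surfX (introT eqP orb1).
  have [apex [apex_in apex_lam apex_base]] := apex_exists surfX stab2.
  have cov := cover_12_surface surfX ftr apex_in apex_lam apex_base vtr.
  split; last first.
    exists (umbrella_cover X); split=> // v u vX umb.
    by rewrite (cycle_class_umbrella surfX vX umb) imset_f.
  split; [exact: lam_sub_aut | exact: lam_trans | | by exists (umbrella_cover X)].
  have [F _] := face_exists surfX.
  by rewrite card_lam // (card_aut_face ftr (valP F)) (stab2 _ (valP F)) mulnC.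
have ftr := face_trans_lam surfX tr; split=> //; split=> [|B BX].
  apply/eqP/(vertex_transP surfX) => v w vX wX.
  (* The cover is a single orbit of cycles, so the umbrellas of [v] and [w] lie in one orbit. *)
  have [E1 [E2 [_ [F1 [F2 [F3 [F4 [sigma [_ [_ _ CE _ _]]]]]]]]]] := covC.
  have [u umb] := umbrella_exists surfX vX; have [t umbt] := umbrella_exists surfX wX.
  have := umbC v u vX umb; have := umbC w t wX umbt; rewrite CE => tC uC.
  exact: (orbit_vertices surfX vX umb umbt uC tC).
have T_gt0 : 0 < #|face X| by have [F _] := face_exists surfX; apply/card_gt0P; exists F.
(* Since [lambda] is injective, the orbit-stabiliser formula equates the number of faces times the
   stabiliser order with twice the number of faces. *)
apply/eqP; rewrite -(eqn_pmul2l T_gt0) -card_aut_face // mulnC -cardH.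
by rewrite card_lam.
Qed.
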